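(* There exist infinitely many (pairwise non-isomorphic) 2-edge-connected cubic graphs $G$ such that for no perfect matching $F$ of $G$ does $G/\overline{F}$ admit a non-conflicting nowhere-zero $\mathbb{Z}_2\times\mathbb{Z}_2$-flow with respect to $\overline{F}$.
   Context: Graphs are finite, loopless, and may have parallel edges. For a perfect matching $F$ of a cubic graph $G$, $\overline{F}=G-F$ is the complementary 2-factor, and $G/\overline{F}$ is the pseudo-graph obtained by contracting each cycle of $\overline{F}$ to a vertex; its edges are the edges of $F$ (edges of $F$ with both ends on one cycle become loops). Write $\mathbb{Z}_2\times\mathbb{Z}_2=\{0,\alpha,\beta,\alpha+\beta\}$. A nowhere-zero $\mathbb{Z}_2\times\mathbb{Z}_2$-flow is an assignment $\theta$ of nonzero elements to the edges such that at every vertex the sum of values on incident edges is $0$ (loops counted twice). Such a flow of $G/\overline{F}$ is non-conflicting with respect to $\overline{F}$ if no edge $uv$ of $\overline{F}$ has $u$ incident to an edge of $F$ with value $\alpha$ and $v$ incident to an edge of $F$ with value $\beta$. *)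

(* Defs.v *)
From HB Require Import structures.
From mathcomp Require Import all_boot all_order all_algebra.

Set Implicit Arguments.
Unset Strict Implicit.
Unset Printing Implicit Defensive.

Import GRing.Theory.
Local Open Scope ring_scope.

(* Finite graphs; parallel edges and loops are allowed.
   The order of the two components of [ends e] carries no meaning: every notion
   below is symmetric in it.  A loop is an edge with equal components. *)
Record pseudograph := Pseudograph {
  vertex : finType;
  edge : finType;
  ends : edge -> vertex * vertex }.

Definition loopless (G : pseudograph) : Prop :=
  forall e : edge G, (ends e).1 != (ends e).2.

(* Number of ends of [e] at [v]; it is 2 for a loop. *)
Definition end_count (G : pseudograph) (e : edge G) (v : vertex G) : nat :=
  (((ends e).1 == v) + ((ends e).2 == v))%N.

Definition incident (G : pseudograph) (e : edge G) (v : vertex G) : bool :=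
  (v == (ends e).1) || (v == (ends e).2).

Definition joins (G : pseudograph) (e : edge G) (u v : vertex G) : bool :=
  (ends e == (u, v)) || (ends e == (v, u)).

Definition degree (G : pseudograph) (v : vertex G) : nat :=
  (\sum_(e : edge G) end_count e v)%N.

Definition cubic (G : pseudograph) : Prop :=
  forall v : vertex G, degree v = 3%N.

(* Adjacency in the spanning subgraph with edge set [D]. *)
Definition adj (G : pseudograph) (D : {set edge G}) : rel (vertex G) :=
  fun u v => [exists e in D, joins e u v].

Definition edge_connected (k : nat) (G : pseudograph) : Prop :=
  (1 < #|vertex G|)%N /\
  forall X : {set edge G}, (#|X| < k)%N ->
    forall u v : vertex G, connect (adj (~: X)) u v.

Definition isomorphic (G H : pseudograph) : Prop :=
  exists (fV : vertex G -> vertex H) (fE : edge G -> edge H),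
    [/\ bijective fV, bijective fE &
        forall (e : edge G) (u v : vertex G),
          joins (fE e) (fV u) (fV v) = joins e u v].

Definition perfect_matching (G : pseudograph) (F : {set edge G}) : Prop :=
  forall v : vertex G, #|[set e in F | incident e v]| = 1%N.

Definition component (G : pseudograph) (D : {set edge G}) (v : vertex G) :
  {set vertex G} := [set u | connect (adj D) v u].

Definition components (G : pseudograph) (D : {set edge G}) :
  {set {set vertex G}} := [set component D v | v : vertex G].

Definition contract_vertex (G : pseudograph) (D : {set edge G})
    (v : vertex G) : {C : {set vertex G} | C \in components D} :=
  exist _ (component D v) (imset_f (component D) (isT : v \in predT)).

(* [contract D] is G/D: the components of the spanning subgraph with edge set
   [D] become vertices, and the edges outside [D] remain.  When [D] is a
   2-factor, those components are exactly its cycles. *)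
Definition contract (G : pseudograph) (D : {set edge G}) : pseudograph :=
  {| vertex := {C : {set vertex G} | C \in components D};
     edge := {e : edge G | e \notin D};
     ends := fun e => (contract_vertex D (ends (val e)).1,
                       contract_vertex D (ends (val e)).2) |}.

Definition alpha : 'Z_2 * 'Z_2 := (1, 0).
Definition beta : 'Z_2 * 'Z_2 := (0, 1).

(* No orientation is needed, since x = - x in Z_2 x Z_2. *)
Definition nowhere_zero_flow (G : pseudograph)
    (theta : edge G -> 'Z_2 * 'Z_2) : Prop :=
  (forall e : edge G, theta e != 0) /\
  (forall v : vertex G, \sum_(e : edge G) theta e *+ end_count e v = 0).

(* [theta] lives on the edges of G/D, but incidence is taken in G. *)
Definition non_conflicting (G : pseudograph) (D : {set edge G})
    (theta : edge (contract D) -> 'Z_2 * 'Z_2) : Prop :=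
  ~ exists (e : edge G) (u v : vertex G) (f g : edge (contract D)),
      [/\ e \in D /\ joins e u v,
          incident (val f) u /\ theta f = alpha &
          incident (val g) v /\ theta g = beta].

(* Main.v *)
Require Import Defs.
From HB Require Import structures.
From mathcomp Require Import all_boot all_order all_algebra.

(* Every edge of a cubic bridgeless graph H is replaced by a copy of the
   Petersen graph with one edge deleted.  A perfect matching F of the resulting
   graph covers a vertex of H, so it contains a link from such a vertex to some
   copy, and by parity both links of that copy: on the copy, F is a perfect
   matching of the Petersen graph through the deleted edge, and the remaining
   edges form two pentagons.  A flow gives the five matching edges leaving a
   pentagon nonzero values with sum 0, and five being odd all three nonzero
   values occur.  Any two edges of a perfect matching of the Petersen graph are
   joined by an edge of the complementary 2-factor, so an edge with value alpha
   and one with value beta are in conflict. *)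

Set Implicit Arguments.
Unset Strict Implicit.
Unset Printing Implicit Defensive.

Import GRing.Theory.
Local Open Scope ring_scope.

(** * Perfect matchings and flows of the contracted graph *)

Lemma incident_end_count (G : pseudograph) (e : edge G) (v : vertex G) :
  loopless G -> end_count e v = incident e v.
Proof.
move=> /(_ e) neq_e; rewrite /end_count /incident ![v == _]eq_sym.
by case: eqP => [<-|_]; rewrite ?add0n // eq_sym (negPf neq_e).
Qed.

Lemma sum_end_count (G : pseudograph) (e : edge G) (A : pred (vertex G)) :
  (\sum_(v | A v) end_count e v = A (ends e).1 + A (ends e).2)%N.
Proof.
have sum1 u : (\sum_(v | A v) (u == v) = A u)%N.
  rewrite big_mkcond (bigD1 u) //= eqxx big1 ?addn0 => [|v]; first by case: (A u).
  by rewrite eq_sym => /negPf->; case: (A v).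
by rewrite big_split /= !sum1.
Qed.

Lemma perfect_matching_edge (G : pseudograph) (F : {set edge G}) (v : vertex G) :
  perfect_matching F -> exists2 e, e \in F & incident e v.
Proof.
move=> /(_ v) /eqP /cards1P[e def_e].
have: e \in [set e in F | incident e v] by rewrite def_e inE.
by rewrite inE => /andP[]; exists e.
Qed.

Lemma perfect_matching_inj (G : pseudograph) (F : {set edge G}) (v : vertex G)
    (e f : edge G) : perfect_matching F -> e \in F -> f \in F ->
  incident e v -> incident f v -> e = f.
Proof.
move=> /(_ v) /eqP /cards1P[g def_g] eF fF ev fv.
have /set1P->: e \in [set g] by rewrite -def_g inE eF.
by apply/esym/set1P; rewrite -def_g inE fF.
Qed.

(* A flow of G/(~: F) is traded for the vertex labelling sending [v] to the
   value of the edge of F at [v]. *)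
Lemma matching_labelling (G : pseudograph) (F : {set edge G})
    (theta : edge (contract (~: F)) -> 'Z_2 * 'Z_2) :
    loopless G -> perfect_matching F ->
    nowhere_zero_flow theta -> non_conflicting theta ->
  exists phi : vertex G -> 'Z_2 * 'Z_2,
  [/\ forall v, phi v != 0,
      forall e, e \in F -> phi (ends e).1 = phi (ends e).2,
      forall e u v, e \notin F -> joins e u v ->
        ~~ ((phi u == alpha) && (phi v == beta)) &
      forall s : seq (vertex G), uniq s ->
        (forall e, e \notin F -> ((ends e).1 \in s) = ((ends e).2 \in s)) ->
        \sum_(v <- s) phi v = 0].
Proof.
move=> loopG matF [theta_neq0 theta_flow] theta_nc.
(* Writing [phi] as a sum, only one term of which survives, lets the last clause follow by
   exchanging summations. *)
pose phi v := \sum_(f : edge (contract (~: F))) theta f *+ end_count (val f) v.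
have valF (f : edge (contract (~: F))) : val f \in F.
  by have := valP f; rewrite inE negbK.
have phiE f v : incident (val f) v -> phi v = theta f.
  move=> fv; rewrite /phi (bigD1 f) //= incident_end_count // fv mulr1n.
  rewrite big1 ?addr0 // => g neq_gf; rewrite incident_end_count //.
  have [gv|] := boolP (incident (val g) v); last by rewrite mulr0n.
  by case/eqP: neq_gf; apply/val_inj/(perfect_matching_inj matF _ _ gv fv).
have liftF e : e \in F -> exists f : edge (contract (~: F)), val f = e.
  by move=> eF; have De : e \notin ~: F by [rewrite inE eF]; exists (exist _ e De).
have phi_ex v : exists2 f : edge (contract (~: F)), incident (val f) v &
    phi v = theta f.
  have [e /liftF[f <-] fv] := perfect_matching_edge v matF.
  by exists f => //; apply: phiE.
exists phi; split.
- by move=> v; have [f _ ->] := phi_ex v.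
- move=> e /liftF[f <-].
  by rewrite !(phiE f) // /incident eqxx ?orbT.
- move=> e u v eF e_uv; apply/negP => /andP[/eqP ua /eqP vb].
  have [f fu fE] := phi_ex u; have [g gv gE] := phi_ex v.
  by apply: theta_nc; exists e, u, v, f, g; rewrite inE eF -fE -gE.
- move=> s Us s_closed; rewrite big_uniq //= exchange_big /=.
  (* Since [s] is a union of components of [~: F], adding the flow equations of the components that
     meet [s] counts exactly the ends in [s]. *)
  pose P (C : vertex (contract (~: F))) := [exists v in val C, v \in s].
  have PE v : P (contract_vertex (~: F) v) = (v \in s).
    apply/exists_inP/idP => [[u]|vs]; last first.
      by exists v => //; rewrite inE connect0.
    rewrite inE => vu; rewrite (@closed_connect _ _ (mem s) _ _ _ vu) //.
    move=> x y /exists_inP[e]; rewrite !inE => /s_closed Ee.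
    by case/orP=> /eqP ee; move: Ee; rewrite ee.
  transitivity (\sum_(C | P C)
      \sum_(f : edge (contract (~: F))) theta f *+ end_count f C); last first.
    by rewrite big1.
  rewrite [RHS]exchange_big; apply: eq_bigr => f _.
  by rewrite !sumrMnr !sum_end_count /= !PE.
Qed.

(** * Connectivity along cycles *)

Lemma adj_sym (G : pseudograph) (D : {set edge G}) : symmetric (adj D).
Proof. by move=> u v; apply: eq_existsb => e; rewrite /joins orbC. Qed.

Lemma connect_adj_sym (G : pseudograph) (D : {set edge G}) :
  connect_sym (adj D).
Proof. by apply: sym_connect_sym; apply: adj_sym. Qed.

Lemma connect_ends (G : pseudograph) (D : {set edge G}) (e : edge G) :
  e \in D -> connect (adj D) (ends e).1 (ends e).2.
Proof.
move=> eD; apply: connect1; apply/exists_inP; exists e => //.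
by rewrite /joins -surjective_pairing eqxx.
Qed.

Lemma connect_cyclic (T : finType) (e : rel T) (n : nat) (w : 'I_n.+1 -> T)
    (j : 'I_n.+1) : connect_sym e ->
    (forall i, i != j -> connect e (w i) (w (ordS i))) ->
  forall i i', connect e (w i) (w i').
Proof.
move=> sym_e w_e.
suff to_j i : connect e (w (ordS j)) (w i).
  by move=> i i'; apply: connect_trans (to_j i'); rewrite sym_e.
pose g k : 'I_n.+1 := inZp (j + k.+1)%N.
have g_step k : (k < n)%N -> connect e (w (g k)) (w (g k.+1)).
  move=> lt_kn; suff ->: g k.+1 = ordS (g k).
    apply: w_e; rewrite -val_eqE /= -{2}(modn_small (ltn_ord j)).
    by rewrite -{2}[val j]addn0 eqn_modDl mod0n modn_small.
  by apply: val_inj; rewrite /= -(addn1 (_ %% _)) modnDml addn1 !addnS.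
have g_conn k : (k <= n)%N -> connect e (w (g 0)) (w (g k)).
  elim: k => [|k IHk] lt_kn; first exact: connect0.
  exact: connect_trans (IHk (ltnW lt_kn)) (g_step k lt_kn).
have -> : ordS j = g 0 by apply: val_inj; rewrite /= addn1.
have [lt_ji|le_ij] := ltnP j i.
  have ->: i = g (i - j.+1)%N.
    by apply: val_inj; rewrite /= -addSnnS subnKC // modn_small.
  by apply: g_conn; rewrite (leq_trans (leq_subr _ _)) // -ltnS.
(* For [i <= j] the walk has wrapped past index 0. *)
have ->: i = g (i + (n - j))%N.
  apply: val_inj; rewrite /= addnS addnCA subnKC -1?ltnS // -addnS modnDr.
  by rewrite modn_small.
by apply: g_conn; rewrite addnBA; [rewrite leq_subLR leq_add2r | rewrite -ltnS].
Qed.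

(** * The Petersen gadget and the expansion *)

(* The Petersen graph minus the edge 0-7.  Entries 0 to 8 form a 9-cycle through
   all vertices but 0.  Each pair is oriented so that, for both perfect matchings
   through 0-7, the first components and the second components are the vertex
   sets of the two complementary pentagons. *)
Definition gadget_edges : seq (nat * nat) :=
  [:: (1, 2); (2, 3); (4, 3); (4, 5); (5, 6); (6, 7); (7, 8); (9, 8); (1, 9);
      (0, 1); (0, 4); (2, 6); (3, 8); (5, 9)]%N.

Definition gadget_ends (k : nat) : 'I_10 * 'I_10 :=
  let pq := nth (0, 0)%N gadget_edges k in (inZp pq.1, inZp pq.2).

(* The edge [(e, inl k)] is the [k]-th edge of the copy replacing [e]; the links
   [(e, inr false)] and [(e, inr true)] attach its vertices 0 and 7 to the ends
   of [e]. *)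
Definition petersen_expansion (H : pseudograph) : pseudograph :=
  {| vertex := (vertex H + edge H * 'I_10)%type;
     edge := (edge H * ('I_14 + bool))%type;
     ends := fun x => match x.2 with
       | inl k => (inr (x.1, (gadget_ends k).1), inr (x.1, (gadget_ends k).2))
       | inr b => (inl (if b then (ends x.1).2 else (ends x.1).1),
                   inr (x.1, inZp (if b then 7 else 0)%N))
       end |}.

Lemma ord_forall_nat (n : nat) (P : 'I_n.+1 -> Prop) :
  (forall k, (k < n.+1)%N -> P (inZp k)) -> forall k, P k.
Proof. by move=> PP k; rewrite -(valZpK k); apply: PP. Qed.

Lemma expansion_loopless (H : pseudograph) : loopless (petersen_expansion H).
Proof.
case=> e [k|b] //=; apply/eqP => -[]; apply/eqP; move: k.
by apply: ord_forall_nat; do 14?[case=> //].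
Qed.

Lemma end_count_gadget (H : pseudograph) (e e' : edge H) (p : 'I_10)
    (y : 'I_14 + bool) :
  (@end_count (petersen_expansion H) (e', y) (inr (e, p)) = (e' == e) *
    match y with
    | inl k => ((gadget_ends k).1 == p) + ((gadget_ends k).2 == p)
    | inr b => inZp (if b then 7 else 0) == p
    end)%N.
Proof.
have inrE (x y' : edge H * 'I_10) :
  (inr x == inr y' :> vertex (petersen_expansion H)) = (x == y') by [].
case: y => [k|b]; rewrite /end_count /= !inrE !xpair_eqE /=;
  by case: (e' == e); rewrite // mul1n.
Qed.

(** The weight [w] will be 1 for degrees, and the indicator of a perfect matching for counting its
    edges at a vertex. *)
Lemma sum_gadget_vertex (H : pseudograph) (e : edge H) (p : 'I_10)
    (w : edge (petersen_expansion H) -> nat) :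
  (\sum_x w x * end_count x (inr (e, p) : vertex (petersen_expansion H)) =
   \sum_(0 <= k < 14) w (e, inl (inZp k)) *
      (((gadget_ends k).1 == p) + ((gadget_ends k).2 == p)) +
   (w (e, inr true) * (inZp 7 == p) + w (e, inr false) * (inZp 0 == p)))%N.
Proof.
rewrite [LHS](eq_bigr (fun x : edge H * ('I_14 + bool) =>
  w (x.1, x.2) * @end_count (petersen_expansion H) (x.1, x.2) (inr (e, p))))%N;
  last by case.
rewrite -(pair_bigA _ (fun e' y =>
  w (e', y) * @end_count (petersen_expansion H) (e', y) (inr (e, p))))%N /=.
rewrite (bigD1 e) //= [X in (_ + X)%N]big1 => [|e' /negPf ne]; last first.
  by rewrite big1 // => y _; rewrite end_count_gadget ne muln0.
rewrite addn0 big_sumType big_mkord big_bool /= !end_count_gadget eqxx !mul1n.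
congr (_ + _)%N; apply: eq_bigr => k _.
by rewrite valZpK end_count_gadget eqxx mul1n.
Qed.

Lemma expansion_cubic (H : pseudograph) :
  cubic H -> cubic (petersen_expansion H).
Proof.
move=> cubH [v|[e p]]; rewrite /degree.
  apply: etrans (cubH v); rewrite /degree.
  rewrite [LHS](eq_bigr (fun x : edge H * ('I_14 + bool) =>
    @end_count (petersen_expansion H) (x.1, x.2) (inl v))); last by case.
  rewrite -(pair_bigA _ (fun e y =>
    @end_count (petersen_expansion H) (e, y) (inl v))) /=.
  apply: eq_bigr => e _.
  rewrite big_sumType big1 // big_bool /end_count /=.
  by rewrite add0n !addn0 addnC.
under eq_bigr do rewrite -[end_count _ _]mul1n.
rewrite (sum_gadget_vertex _ _ (fun=> 1%N)); move: p.
apply: ord_forall_nat; do 10?[case=> [|]] => // _;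
  by rewrite unlock.
Qed.

(** * Matchings and conflicts in one copy *)

Lemma perfect_matching_sum (G : pseudograph) (F : {set edge G}) (v : vertex G) :
  loopless G -> perfect_matching F ->
  (\sum_e (e \in F) * end_count e v = 1)%N.
Proof.
move=> loopG /(_ v) matF; apply: etrans matF; rewrite -sum1_card [RHS]big_mkcond.
apply: eq_bigr => e _; rewrite inE incident_end_count //.
by case: (e \in F); case: incident.
Qed.

(** With one link only, nine vertices would have to be paired among themselves. With both, the two
    outcomes are the two perfect matchings of the Petersen graph through the edge 0-7. *)
Lemma gadget_matchings (m : nat -> bool) (l7 l0 : bool) :
    (forall p : 'I_10, (\sum_(0 <= k < 14) m k *
      (((gadget_ends k).1 == p) + ((gadget_ends k).2 == p)) +
      (l7 * (inZp 7 == p) + l0 * (inZp 0 == p)) = 1)%N) ->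
    l7 || l0 ->
  [/\ l7, l0 & mkseq m 14 = mkseq (fun k => k \in [:: 0; 2; 4; 7])%N 14 \/
                mkseq m 14 = mkseq (fun k => k \in [:: 3; 8; 11; 12])%N 14].
Proof.
move=> mp; rewrite /mkseq /=.
have E p := mp (inZp p).
(* The equations are ordered so that each is settled once the edges at its vertex have been split
   on, and dead branches close early. *)
move: (E 0%N) (E 7%N) (E 1%N) (E 2%N) (E 3%N) (E 4%N) (E 5%N)
  (E 6%N) (E 8%N) (E 9%N).
rewrite unlock /= !(muln0, muln1, addn0, add0n) => {mp E}.
case: l7; case: l0; case: (m 9%N); case: (m 10%N) => // _;
  case: (m 5%N); case: (m 6%N) => // _; case: (m 0%N); case: (m 8%N) => // _;
  case: (m 1%N); case: (m 11%N) => // _; case: (m 2%N); case: (m 12%N) => // _;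
  case: (m 3%N) => // _; case: (m 4%N); case: (m 13%N) => // _ // _;
  case: (m 7%N) => // _ // _ // _; split=> //; by [left | right].
Qed.

Lemma odd_zero_sum (s : seq ('Z_2 * 'Z_2)) :
  odd (size s) -> 0 \notin s -> \sum_(x <- s) x = 0 ->
  alpha \in s /\ beta \in s.
Proof.
move=> odd_s s0 sum_s.
have Z2 (a : 'Z_2) : a != 0 -> a = 1.
  by case: a => [[|[|//]]] // lt_a _; apply: val_inj.
have odd_natr : (size s)%:R = 1 :> 'Z_2.
  have two0 : 2%:R = 0 :> 'Z_2 by apply: val_inj.
  by rewrite -(odd_double_half (size s)) odd_s natrD -muln2 natrM two0 mulr0 addr0.
have sum_one (f : 'Z_2 * 'Z_2 -> 'Z_2) :
    (forall x, x \in s -> f x = 1) -> \sum_(x <- s) f x = 1.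
  move=> f1; rewrite big_seq (eq_bigr (fun=> 1)) // -big_seq.
  by rewrite big_const_seq count_predT iter_addr_0.
(* If alpha = (1, 0) is not in [s], all second components equal 1. *)
split; apply/negPn/negP => s_x.
- have: (\sum_(x <- s) x).2 = 1.
    rewrite (big_morph snd (id1 := 0) (op1 := +%R)) // sum_one // => -[a b] ab_s.
    apply/Z2; apply: contra s0 => /= /eqP b0; move: ab_s; rewrite b0.
    case: (eqVneq a 0) => [-> //|/Z2 -> s_a]; by case/negP: s_x.
  by rewrite sum_s.
- have: (\sum_(x <- s) x).1 = 1.
    rewrite (big_morph fst (id1 := 0) (op1 := +%R)) // sum_one // => -[a b] ab_s.
    apply/Z2; apply: contra s0 => /= /eqP b0; move: ab_s; rewrite b0.
    case: (eqVneq b 0) => [-> //|/Z2 -> s_a]; by case/negP: s_x.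
  by rewrite sum_s.
Qed.

Definition touches (k : nat) (a b : nat * nat) : bool :=
  let pq := nth (0, 0)%N gadget_edges k in
  (pq.1 \in [:: a.1; a.2]) && (pq.2 \in [:: b.1; b.2]).

(** In the Petersen graph, two matching edges whose ends are not consecutive on one pentagon have
    consecutive ends on the other. *)
Definition pairwise_joined (M : seq nat) (P : seq (nat * nat)) : bool :=
  all2rel (fun a b => (a == b) ||
    has (fun k => (k \notin M) && (touches k a b || touches k b a)) (iota 0 14)) P.

(** By [odd_zero_sum] some pair has value [alpha] and another [beta]. As [u] is constant on pairs,
    any edge outside [M] joining the two conflicts, whichever ends it meets. *)
Lemma gadget_conflict (M : seq nat) (P : seq (nat * nat))
    (u : nat -> 'Z_2 * 'Z_2) :
    pairwise_joined M P ->
    odd (size P) -> (forall p, u p != 0) ->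
    (forall a, a \in P -> u a.1 = u a.2) -> \sum_(a <- P) u a.1 = 0 ->
  exists2 k, (k < 14)%N && (k \notin M) &
    let pq := nth (0, 0)%N gadget_edges k in
    (u pq.1 == alpha) && (u pq.2 == beta) ||
    (u pq.2 == alpha) && (u pq.1 == beta).
Proof.
move=> /allrelP linkP oddP u0 uP sum1.
have [|||/mapP[a aP ua] /mapP[b bP ub]] := @odd_zero_sum [seq u a.1 | a <- P].
- by rewrite size_map.
- by apply/mapP => -[a _ /esym/eqP]; rewrite (negPf (u0 _)).
- by rewrite big_map.
have uE c p : c \in P -> p \in [:: c.1; c.2] -> u p = u c.1.
  by move=> cP; rewrite !inE => /orP[] /eqP -> //; rewrite uP.
have /orP[/eqP eq_ab|/hasP[k]] := linkP _ _ aP bP.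
  by have := ua; rewrite eq_ab -ub.
rewrite mem_iota => lt_k /andP[kM kab]; exists k; first by rewrite kM andbT.
move: kab; rewrite /touches; case: (nth _ _ k) => p q /= /orP[] /andP[kp kq].
  by rewrite (uE a _ aP kp) (uE b _ bP kq) -ua -ub !eqxx.
by rewrite (uE a _ aP kq) (uE b _ bP kp) -ua -ub !eqxx orbT.
Qed.

(** Testing the 14 inner edges suffices when both links are in the matching: no other edge outside
    it then meets the copy. *)
Definition union_of_cycles (M s : seq nat) : bool :=
  [&& uniq s, all (gtn 10) s &
      all (fun k => let pq := nth (0, 0)%N gadget_edges k in
        (k \in M) || ((pq.1 \in s) == (pq.2 \in s))) (iota 0 14)].

(* The pair (0, 7) stands for the deleted edge, that is, for both links. *)
Definition petersen_matching (M : seq nat) : seq (nat * nat) :=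
  (0, 7)%N :: [seq nth (0, 0)%N gadget_edges k | k <- M].

Lemma gadget_endsE (k : nat) (pq := nth (0, 0)%N gadget_edges k) :
  ((gadget_ends k).1 = pq.1 :> nat) * ((gadget_ends k).2 = pq.2 :> nat).
Proof.
have: all (fun pq => (pq.1 < 10) && (pq.2 < 10))%N gadget_edges by [].
move=> /(all_nthP (0, 0)%N) /(_ k); rewrite -/pq.
have [_ /(_ isT) /andP[? ?]|] := ltnP k (size gadget_edges).
  by rewrite /= !modn_small.
by move=> le_k _; rewrite /= /pq nth_default.
Qed.

Lemma expansion_no_flow (H : pseudograph) (v : vertex H)
    (F : {set edge (petersen_expansion H)}) : perfect_matching F ->
  ~ exists theta : edge (contract (~: F)) -> ('Z_2 * 'Z_2)%type,
      nowhere_zero_flow theta /\ non_conflicting theta.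
Proof.
move=> matF [theta [flow_theta nc_theta]].
have loopG := @expansion_loopless H.
have [phi [phi0 phiF phi_nc phi_sum]] :=
  matching_labelling loopG matF flow_theta nc_theta.
(* Inner edges of copies miss [inl v], so the matching edge there is a link; its copy is the one
   studied below. *)
have [[e [k|b]] eF] :=
  perfect_matching_edge (inl v : vertex (petersen_expansion H)) matF => //.
move=> _.
pose m k := (e, inl (inZp k)) \in F.
pose u p := phi (inr (e, inZp p)).
have u0 p : u p != 0 by apply: phi0.
have [||l7 l0 mE] :=
  @gadget_matchings m ((e, inr true) \in F) ((e, inr false) \in F).
- move=> p; rewrite -[RHS](@perfect_matching_sum _ F (inr (e, p)) loopG matF).
  by rewrite sum_gadget_vertex.
- by case: b eF => ->; rewrite ?orbT.
have sum0 (M s : seq nat) : (forall k, (k < 14)%N -> m k = (k \in M)) ->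
    union_of_cycles M s -> \sum_(p <- s) u p = 0.
  move=> mM /and3P[Us s10 s_closed].
  pose c p : vertex (petersen_expansion H) := inr (e, inZp p).
  have mem_c e' q : ((inr (e', q) : vertex (petersen_expansion H)) \in map c s)
      = (e' == e) && ((q : nat) \in s).
    apply/mapP/andP => [[p ps [-> ->]]|[/eqP-> qs]].
      by rewrite /= modn_small //; apply: (allP s10).
    by exists (q : nat) => //; rewrite /c valZpK.
  rewrite -(big_map c predT phi); apply: phi_sum => [|[e' [k|b']] xF /=].
  - rewrite map_inj_in_uniq // => p q ps qs [].
    by rewrite !modn_small //; apply: (allP s10).
  - rewrite !mem_c; case: eqP => [e'E|//]; rewrite !andTb.
    move: xF; rewrite e'E => xF.
    have /(allP s_closed) : (k : nat) \in iota 0 14 by rewrite mem_iota /=.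
    by rewrite -mM // /m valZpK (negPf xF) !gadget_endsE => /eqP.
  - rewrite mem_c; case: eqP => [e'E|_].
      by move: xF; rewrite e'E; case: b'; rewrite ?l7 ?l0.
    by apply/mapP => -[].
(* Both matchings meet the same decidable conditions; the last two make the first ends and the
   second ends of the five pairs closed under the 2-factor. *)
suff conflict (M : seq nat) (P := petersen_matching M) :
    mkseq m 14 = mkseq (fun k => k \in M) 14 -> all (gtn 14) M ->
    odd (size P) -> pairwise_joined M P ->
    union_of_cycles M [seq a.1 | a <- P] ->
    union_of_cycles M [seq a.2 | a <- P] -> False.
  by case: mE => /conflict; apply; vm_compute.
move=> eq_mM M14 oddP linkP cycle1 cycle2.
have mM k : (k < 14)%N -> m k = (k \in M).
  by move=> lt_k; have := congr1 (nth false ^~ k) eq_mM; rewrite !nth_mkseq.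
have := sum0 _ _ mM cycle2; have sum1 := sum0 _ _ mM cycle1.
have uM k : k \in M ->
    u (nth (0, 0)%N gadget_edges k).1 = u (nth (0, 0)%N gadget_edges k).2.
  move=> kM; have lt_k := allP M14 k kM; have := kM.
  by rewrite -mM // => /phiF /=; rewrite modn_small.
(* The links are two different edges, so [phiF] does not equate [u 0] and [u 7]. The two pentagon
   sums do: both vanish, and they agree on the four inner matching edges. *)
move: (sum1); rewrite !big_map !big_cons !big_map /= -(eq_big_seq _ uM).
move=> sum1' sum2; have u07 := addIr _ (etrans sum1' (esym sum2)).
have uP a : a \in P -> u a.1 = u a.2.
  by rewrite inE => /predU1P[-> /=|/mapP[k /uM ? ->]].
rewrite big_map in sum1.
have [k /andP[lt_k kM]] := gadget_conflict linkP oddP u0 uP sum1.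
pose x : edge (petersen_expansion H) := (e, inl (inZp k)).
have xF : x \notin F by rewrite -[x \in F]/(m k) mM.
have [uk1 uk2] : u (nth (0, 0)%N gadget_edges k).1 = phi (ends x).1 /\
           u (nth (0, 0)%N gadget_edges k).2 = phi (ends x).2.
  by rewrite /= modn_small.
case/orP; rewrite uk1 uk2; apply/negP; apply: (phi_nc _ _ _ xF).
  by rewrite /joins -surjective_pairing eqxx.
by rewrite /joins -surjective_pairing eqxx orbT.
Qed.

(** * Edge-connectivity of the expansion *)

Lemma card_lt2_notin (T : finType) (A : {set T}) (x y : T) :
  (#|A| < 2)%N -> x != y -> x \in A -> y \notin A.
Proof.
rewrite ltnS => /card_le1_eqP A1 neq_xy xA; apply: contraNN neq_xy => yA.
by rewrite (A1 _ _ xA yA).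
Qed.

Lemma card_lt2_avoid (T : finType) (A : {set T}) (n : nat) (f : 'I_n.+1 -> T) :
  (#|A| < 2)%N -> injective f -> exists j, forall i, i != j -> f i \notin A.
Proof.
move=> A2 inj_f; have [j jA|noA] := pickP (fun i => f i \in A).
  by exists j => i; rewrite eq_sym -(inj_eq inj_f) => /card_lt2_notin; apply.
by exists ord0 => i _; rewrite noA.
Qed.

(** The 9-cycle survives the loss of one edge, and vertex 0 is attached to it by the two edges 9 and
    10. *)
Lemma gadget_connect (H : pseudograph) (X : {set edge (petersen_expansion H)})
    (e : edge H) (p q : 'I_10) : (#|X| < 2)%N ->
  connect (adj (~: X)) (inr (e, p) : vertex (petersen_expansion H)) (inr (e, q)).
Proof.
move=> X2.
pose c k : vertex (petersen_expansion H) := inr (e, inZp k).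
pose x k : edge (petersen_expansion H) := (e, inl (inZp k)).
have sym_c := @connect_adj_sym (petersen_expansion H) (~: X).
have c_x k (pq := nth (0, 0)%N gadget_edges k) : (k < 14)%N -> x k \notin X ->
    connect (adj (~: X)) (c pq.1) (c pq.2).
  move=> lt_k kX; have := @connect_ends (petersen_expansion H) (~: X) (x k).
  by rewrite inE kX /= modn_small //; apply.
have x_inj (i i' : 'I_9) : x i = x i' -> i = i'.
  move=> [/eqP]; rewrite !modn_small; first by move=> /eqP; apply: val_inj.
    exact: leq_trans (ltn_ord i') _.
  exact: leq_trans (ltn_ord i) _.
have [j j_max] := card_lt2_avoid X2 x_inj.
have c9 (i i' : 'I_9) : connect (adj (~: X)) (c i.+1) (c i'.+1).
  apply: (connect_cyclic (w := fun i : 'I_9 => c i.+1) sym_c (j := j)) => k.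
  move=> /j_max /(c_x k (leq_trans (ltn_ord k) (isT : 9 <= 14)%N)).
  (* Entries 2, 7 and 8 are oriented against the cycle. *)
  case: k; do 9?[case=> [|]] => //= _ c_k;
    by [exact: c_k | rewrite sym_c; exact: c_k].
suff to1 (r : 'I_10) : connect (adj (~: X)) (inr (e, r)) (c 1%N).
  by apply: connect_trans (to1 p) _; rewrite sym_c to1.
rewrite -(valZpK r) -/(c r); case: r => [[|r] lt_r] /=; last first.
  exact: (c9 (Ordinal (lt_r : (r < 9)%N)) ord0).
have [x9|/negPn x9] := boolP (x 9%N \notin X); first exact: c_x x9.
apply: connect_trans (c9 (inZp 3) ord0); apply: (c_x 10%N isT).
by apply: card_lt2_notin X2 _ x9; rewrite xpair_eqE eqxx.
Qed.

Lemma expansion_edge_connected (H : pseudograph) :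
  edge_connected 2 H -> edge_connected 2 (petersen_expansion H).
Proof.
move=> [/card_gt1P[u0 [v0 [_ _ neq_uv]]] connH]; split.
  apply/card_gt1P; exists (inl u0), (inl v0); split=> //.
move=> X X2; pose G := petersen_expansion H.
have sym_X := @connect_adj_sym G (~: X).
have link e b : (e, inr b) \notin X -> connect (adj (~: X))
    (inl (if b then (ends e).2 else (ends e).1) : vertex G) (inr (e, ord0)).
  move=> ebX; have := @connect_ends G (~: X) (e, inr b).
  rewrite inE => /(_ ebX) /= /connect_trans; apply; exact: gadget_connect.
(* An edge of [H] outside [Y] keeps both links, so it can still be traversed through its copy; paths
   of [H] avoiding [Y] therefore lift. *)
pose Y := [set e | ((e, inr true) \in X) || ((e, inr false) \in X)].
have Y2 : (#|Y| < 2)%N.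
  rewrite ltnS; apply/card_le1_eqP => e f; rewrite !inE => eX fX.
  apply/eqP/negPn/negP => neq_ef.
  have fX' b : (f, inr b) \notin X.
    case/orP: eX; apply: card_lt2_notin => //;
      by rewrite xpair_eqE eq_sym (negPf neq_ef).
  by rewrite !(negPf (fX' _)) in fX.
have inl_conn u v : connect (adj (~: X)) (inl u : vertex G) (inl v).
  have /connectP[p] := connH Y Y2 u v.
  elim: p u => [u _ ->|w p IHp u /= /andP[/exists_inP[e eY e_uw] /IHp IH /IH]] //.
  apply: connect_trans.
  move: eY; rewrite !inE negb_or => /andP[/link l1 /link l0].
  have e12 : connect (adj (~: X)) (inl (ends e).1 : vertex G) (inl (ends e).2).
    by apply: connect_trans l0 _; rewrite sym_X.
  by case/orP: e_uw => /eqP eE; rewrite eE /= in e12; rewrite // sym_X.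
have to_inl z : exists v, connect (adj (~: X)) z (inl v : vertex G).
  case: z => [v|[e p]]; first by exists v.
  have [b ebX] : exists b, (e, inr b) \notin X.
    have [eX|] := boolP ((e, inr true) \in X); last by exists true.
    by exists false; apply: card_lt2_notin X2 _ eX; rewrite xpair_eqE eqxx.
  exists (if b then (ends e).2 else (ends e).1); rewrite sym_X.
  by apply: connect_trans (link e b ebX) _; apply: gadget_connect.
move=> y z; have [u yu] := to_inl y; have [v zv] := to_inl z.
apply: connect_trans yu (connect_trans (inl_conn u v) _).
by rewrite sym_X.
Qed.

(** * An infinite family of base graphs *)

(** A ring of digons; for [n = 0] the ring edge is a third parallel edge. *)
Definition necklace (n : nat) : pseudograph :=
  {| vertex := ('I_n.+1 * bool)%type;
     edge := ('I_n.+1 * bool + 'I_n.+1)%type;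
     ends := fun e => match e with
       | inl (i, _) => ((i, false), (i, true))
       | inr i => ((i, true), (ordS i, false))
       end |}.

Lemma necklace_cubic (n : nat) : cubic (necklace n).
Proof.
case=> i b; rewrite /degree big_sumType /=.
have sum_eq (T : finType) (a : T) : (\sum_x (x == a) = 1)%N.
  by rewrite (bigD1 a) //= eqxx big1 ?addn0 // => x /negPf->.
rewrite (eq_bigr (fun x : 'I_n.+1 * bool => nat_of_bool (x.1 == i))); last first.
  by case=> j c _; rewrite /end_count /= !xpair_eqE; case: b; case: eqP.
rewrite -(pair_bigA _ (fun j _ => nat_of_bool (j == i))) /=.
rewrite exchange_big big_bool /= !sum_eq.
rewrite [X in (_ + X)%N](_ : _ = 1)%N //.
rewrite /end_count /=; case: b.
  rewrite -[RHS](sum_eq _ i); apply: eq_bigr => j _.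
  by rewrite !xpair_eqE !andbT andbF addn0.
rewrite -[RHS](sum_eq _ (ord_pred i)); apply: eq_bigr => j _.
by rewrite !xpair_eqE !andbT andbF -[in RHS](can_eq (@ordSK n.+1)) ord_predK.
Qed.

(** Each digon keeps one of its parallel edges, and the ring loses at most one step. *)
Lemma necklace_edge_connected (n : nat) : edge_connected 2 (necklace n).
Proof.
split; first by rewrite card_prod card_ord card_bool mulSn.
move=> X X2; have sym_X := @connect_adj_sym (necklace n) (~: X).
have in_bead i b : connect (adj (~: X)) ((i, b) : vertex (necklace n)) (i, true).
  case: b; first exact: connect0.
  have [c cX] : exists c, (inl (i, c) : edge (necklace n)) \notin X.
    have [iX|] := boolP ((inl (i, true) : edge (necklace n)) \in X);
      last by exists true.
    by exists false; apply: card_lt2_notin X2 _ iX; apply/eqP => -[].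
  by have := @connect_ends (necklace n) (~: X) (inl (i, c)); rewrite inE; apply.
have inj_inr : injective (inr : 'I_n.+1 -> edge (necklace n)) by move=> i j [].
have [j j_max] := card_lt2_avoid X2 inj_inr.
have cyc := connect_cyclic (w := fun i => (i, true) : vertex (necklace n))
  (j := j) sym_X.
move=> [i b] [i' b']; apply: connect_trans (in_bead i b) _.
rewrite sym_X; apply: connect_trans (in_bead i' b') _; apply: cyc => k /j_max kX.
have := @connect_ends (necklace n) (~: X) (inr k); rewrite inE => /(_ kX) /=.
by move=> /connect_trans; apply.
Qed.

(** A bead has 2 vertices and accounts for 3 edges, each bringing 10 more. Distinct counts will rule
    out isomorphism. *)
Lemma card_expansion_necklace (n : nat) :
  (#|vertex (petersen_expansion (necklace n))| = n.+1 * 32)%N.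
Proof.
rewrite card_sum !card_prod card_sum card_prod !card_ord card_bool.
by rewrite mulnDl -mulnA -!mulnDr.
Qed.

Theorem theorem5 :
  exists G : nat -> pseudograph,
    (forall i j : nat, i <> j -> ~ isomorphic (G i) (G j)) /\
    (forall i : nat,
      [/\ loopless (G i), cubic (G i), edge_connected 2 (G i) &
          forall F : {set edge (G i)}, perfect_matching F ->
            ~ exists theta : edge (contract (~: F)) -> ('Z_2 * 'Z_2)%type,
                nowhere_zero_flow theta /\ non_conflicting theta]).
Proof.
exists (fun n => petersen_expansion (necklace n)); split.
  move=> i j neq_ij [f [_ [/bij_eq_card + _ _]]].
  by rewrite !card_expansion_necklace => /eqP; rewrite eqn_pmul2r // => /eqP[].
move=> n; split.
- exact: expansion_loopless.
- exact/expansion_cubic/necklace_cubic.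
- exact/expansion_edge_connected/necklace_edge_connected.
- move=> F; apply: expansion_no_flow; exact: (ord0, true).
Qed.
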